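(* Let $(\mathbf{X}_t)_{t\ge 0}$ be a geometric opinion dynamics (as defined in the context) with $n$ agents in dimension $d$. The following are equivalent: (1) For every starting configuration $\mathbf{X}_0\in(\mathbb{S}^{d-1})^n$, $\Pr_{\mathbf{X}_0}\big(\rho(\mathbf{X}_t,P)\to 0\big)=1$. (2) There exists a constant $c>0$ such that for every starting configuration $\mathbf{X}_0\in(\mathbb{S}^{d-1})^n$, $\Pr_{\mathbf{X}_0}\big(\rho(\mathbf{X}_t,P)\to 0\big)\ge c$.
   Context: Fix integers $n\ge 1$ (number of agents) and $d\ge 1$ (dimension). Let $\mathbb{S}^{d-1}=\{\mathbf{x}\in\mathbb{R}^d:\|\mathbf{x}\|_2=1\}$ and $P_{\mathbb{S}^{d-1}}(\mathbf{x})=\mathbf{x}/\|\mathbf{x}\|_2$ for $\mathbf{x}\neq\mathbf{0}$. A geometric opinion dynamics is the Markov chain $\mathbf{X}_t=(\mathbf{X}_t^{(1)},\ldots,\mathbf{X}_t^{(n)})$ on $(\mathbb{S}^{d-1})^n$ defined by $\mathbf{X}_{t+1}^{(i)}=P_{\mathbb{S}^{d-1}}\big(\mathbf{X}_t^{(i)}+f_i(\mathbf{X}_t^{(1)},\ldots,\mathbf{X}_t^{(n)},\xi_t)\big)$, where $\mathbf{X}_0$ is a given starting configuration, the $\xi_t\in\mathbb{S}^{d-1}$ are drawn i.i.d. over time from a fixed distribution $\mathcal{D}$ independently of everything else, each $f_i:(\mathbb{S}^{d-1})^{n+1}\to\mathbb{R}^d$ is a fixed measurable function, and the unnormalized vector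 $\mathbf{X}_t^{(i)}+f_i(\cdots)$ is assumed to be always nonzero. $\Pr_{\mathbf{X}_0}$ denotes probability for the chain started at $\mathbf{X}_0$. The polarized set is $P=\{(\sigma_1\mathbf{x},\ldots,\sigma_n\mathbf{x}):\mathbf{x}\in\mathbb{S}^{d-1},\ \bm{\sigma}\in\{-1,1\}^n\}$, and $\rho(\mathbf{z},A)=\inf_{\mathbf{y}\in A}\|\mathbf{z}-\mathbf{y}\|_2$ is Euclidean distance in $(\mathbb{R}^d)^n$. *)

(* Defs.v *)
From HB Require Import structures.
From mathcomp Require Import all_boot all_order all_algebra.
From mathcomp Require Import all_classical all_reals all_analysis.
Set Implicit Arguments. Unset Strict Implicit. Unset Printing Implicit Defensive.
Import Order.TTheory GRing.Theory Num.Theory.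
Import numFieldNormedType.Exports.
Local Open Scope classical_set_scope.
Local Open Scope ring_scope.

Definition borel_sets (X : topologicalType) : set (set X) :=
  <<s [set U : set X | open U] >>.

Definition enorm (R : realType) (d : nat) (v : 'rV[R]_d) : R :=
  Num.sqrt (\sum_(j < d) v ord0 j ^+ 2).

(* Euclidean norm on (R^d)^n; a configuration is an n x d matrix whose
   i-th row is the opinion of agent i. *)
Definition enormM (R : realType) (n d : nat) (A : 'M[R]_(n, d)) : R :=
  Num.sqrt (\sum_(i < n) \sum_(j < d) A i j ^+ 2).

Definition sphere (R : realType) (d : nat) : set 'rV[R]_d :=
  [set x | enorm x = 1].
Arguments sphere : clear implicits.

Definition sphere_config (R : realType) (n d : nat) : set 'M[R]_(n, d) :=
  [set X | forall i : 'I_n, row i X \in sphere R d].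
Arguments sphere_config : clear implicits.

(* Projection onto the sphere x / ||x||_2 (only used on nonzero vectors). *)
Definition proj_sphere (R : realType) (d : nat) (x : 'rV[R]_d) : 'rV[R]_d :=
  (enorm x)^-1 *: x.

Definition gstep (R : realType) (n d : nat)
  (f : 'I_n -> 'M[R]_(n, d) -> 'rV[R]_d -> 'rV[R]_d)
  (X : 'M[R]_(n, d)) (z : 'rV[R]_d) : 'M[R]_(n, d) :=
  \matrix_(i < n, j < d) proj_sphere (row i X + f i X z) ord0 j.

Fixpoint traj (R : realType) (n d : nat) (T : Type)
  (f : 'I_n -> 'M[R]_(n, d) -> 'rV[R]_d -> 'rV[R]_d)
  (xi : nat -> T -> 'rV[R]_d) (X0 : 'M[R]_(n, d)) (w : T) (t : nat)
  : 'M[R]_(n, d) :=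
  match t with
  | 0 => X0
  | t'.+1 => gstep f (traj f xi X0 w t') (xi t' w)
  end.

Definition polarized (R : realType) (n d : nat) : set 'M[R]_(n, d) :=
  [set Y | exists x : 'rV[R]_d, x \in sphere R d /\
     exists s : 'I_n -> bool,
       Y = \matrix_(i < n, j < d) (if s i then x ord0 j else - x ord0 j)].
Arguments polarized : clear implicits.

Definition dist_set (R : realType) (n d : nat) (Z : 'M[R]_(n, d))
  (A : set 'M[R]_(n, d)) : R :=
  inf [set enormM (Z - Y) | Y in A].

Definition polarization_event (R : realType) (n d : nat) (T : Type)
  (f : 'I_n -> 'M[R]_(n, d) -> 'rV[R]_d -> 'rV[R]_d)
  (xi : nat -> T -> 'rV[R]_d) (X0 : 'M[R]_(n, d)) : set T :=
  [set w | (fun t => dist_set (traj f xi X0 w t) (polarized R n d)) @ \oo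
            --> (0 : R)].

Definition iid_sphere_noise (R : realType) (d : nat) (dT : measure_display)
  (T : measurableType dT) (P : probability T R) (xi : nat -> T -> 'rV[R]_d)
  : Prop :=
  [/\ (forall t B, borel_sets B -> measurable (xi t @^-1` B)),
      (forall t w, xi t w \in sphere R d),
      (forall t B, borel_sets B -> P (xi t @^-1` B) = P (xi 0%N @^-1` B)) &
      (forall (s : seq nat) (B : nat -> set 'rV[R]_d), uniq s ->
         (forall t, borel_sets (B t)) ->
         P (\bigcap_(t in [set` s]) (xi t @^-1` B t)) =
         (\prod_(t <- s) P (xi t @^-1` B t))%E)].

(* Measurability of f_i : (S^{d-1})^{n+1} -> R^d for the Borel structures
   (the domain being the Borel subset (S^{d-1})^n x S^{d-1} of
   (R^d)^n x R^d). *)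
Definition measurable_on_spheres (R : realType) (n d : nat)
  (g : 'M[R]_(n, d) -> 'rV[R]_d -> 'rV[R]_d) : Prop :=
  forall B : set 'rV[R]_d, borel_sets B ->
    borel_sets ([set p : 'M[R]_(n, d) * 'rV[R]_d |
                   sphere_config R n d p.1 /\ p.2 \in sphere R d
                   /\ B (g p.1 p.2)]).

(* Main.v *)
(** Transport everything to the law [mu] of the noise on the space of sequences.
For a starting point [x], let [E_x] be the set of noise sequences along which
the chain started at [x] polarizes. Splicing the first [t] coordinates of one
sequence with an independent copy preserves [mu], and polarization only depends
on the future of the chain, so by Fubini (the Markov property)
[mu (B `&` E_x) >= c * mu B] for every [B] determined by the first [t]
coordinates. Such sets [B] form an algebra generating the sigma-algebra, hence
approximate the complement of [E_x] arbitrarily well, and the inequality forces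
that complement to be null. This replaces Levy's zero-one law. *)

Require Import Defs.
From HB Require Import structures.
From mathcomp Require Import all_boot all_order all_algebra.
From mathcomp Require Import all_classical all_reals all_analysis.
From mathcomp Require Import measurable_realfun lra.
Import Order.TTheory GRing.Theory Num.Theory.
Import numFieldNormedType.Exports.
Local Open Scope classical_set_scope.
Local Open Scope ring_scope.
Set Implicit Arguments. Unset Strict Implicit. Unset Printing Implicit Defensive.

(** * Borel measurability of matrix-valued maps, stated entry by entry *)

Definition measurable_entries {R : realType} {dO : measure_display}
    {O : measurableType dO} {m k : nat} (u : O -> 'M[R]_(m, k)) : Prop :=
  forall i j, measurable_fun setT (fun w => u w i j).

Section borel_matrices.
Context {R : realType} {dO : measure_display} {O : measurableType dO}.

(** Balls of matrices are those of the entrywise maximum norm, hence finite intersections of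
    conditions on single entries. *)
Lemma measurable_mx_ball m k (u : O -> 'M[R]_(m, k)) (Q : 'M[R]_(m, k)) (e : R) :
  0 < e -> measurable_entries u -> measurable [set w | ball Q e (u w)].
Proof.
move=> e0 mu.
rewrite (_ : [set w | _] =
    \bigcap_(i in @setT 'I_m) \bigcap_(j in @setT 'I_k)
       (fun w => u w i j) @^-1` ball (Q i j) e).
  apply: fin_bigcap_measurable => // i _.
  apply: fin_bigcap_measurable => // j _.
  rewrite -[X in measurable X]setTI; apply: mu => //.
  by apply: open_measurable; exact: ball_open.
apply/seteqP; split=> w /=.
  by move=> [_ h] i _ j _; exact: h.
by move=> h; split => // i j; exact: h.
Qed.

Lemma dense_rat_mx m k (A : 'M[R]_(m, k)) (e : R) : 0 < e ->
  exists q : 'M[rat]_(m, k), ball (map_mx ratr q : 'M[R]_(m, k)) e A.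
Proof.
move=> e0.
have h i j : exists q : rat, ball (ratr q : R) e (A i j).
  have /rat_in_itvoo[q] : A i j - e < A i j + e by lra.
  rewrite in_itv /= => /andP[h1 h2]; exists q.
  by rewrite /ball /= ltr_norml; apply/andP; split; lra.
pose q i j := sval (cid (h i j)).
exists (\matrix_(i, j) q i j); split => // i j.
by rewrite !mxE /q; case: cid.
Qed.

(* Second countability: an open set is the union of the balls with rational
   centre and radius [1 / N.+1] that it contains. *)
Lemma measurable_pair_borel m k p q (u : O -> 'M[R]_(m, k))
    (v : O -> 'M[R]_(p, q)) (B : set ('M[R]_(m, k) * 'M[R]_(p, q))) :
  measurable_entries u -> measurable_entries v -> borel_sets B ->
  measurable [set w | B (u w, v w)].
Proof.
move=> mu mv; move: B.
apply: (@smallest_sub _ _ _ [set B | measurable [set w | B (u w, v w)]]).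
  split => /=.
  - exact: measurable0.
  - move=> A /measurableC; rewrite (_ : ~` _ =
      [set w | ([set: _] `\` A) (u w, v w)]) //.
    by apply/seteqP; split => w /=; tauto.
  - by move=> F mF; apply: (bigcupT_measurable (fun k => [set w | F k (u w, v w)])).
move=> U /= oU.
pose c (x : 'M[rat]_(m, k) * 'M[rat]_(p, q)) : 'M[R]_(m, k) * 'M[R]_(p, q) :=
  (map_mx ratr x.1, map_mx ratr x.2).
pose F (x : 'M[rat]_(m, k) * 'M[rat]_(p, q) * nat) :=
  if pselect (ball (c x.1) x.2.+1%:R^-1 `<=` U)
  then [set w | ball (c x.1) x.2.+1%:R^-1 (u w, v w)] else set0.
rewrite (_ : [set w | _] = \bigcup_x F x).
  apply: countable_bigcupT_measurable => [|x]; first exact: countableP.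
  rewrite /F; case: pselect => xU //=.
  by apply: measurableI; apply: measurable_mx_ball.
apply/seteqP; split => w /=; last first.
  by move=> [x _]; rewrite /F; case: pselect => // xU /xU.
move=> Uw.
have /nbhs_ballP[e /= e0 eU] : nbhs (u w, v w) U by exact: open_nbhs_nbhs.
have e20 : 0 < e / 2 by rewrite divr_gt0.
(* With a radius below [e / 2], any two points of the same ball are within [e] of each other, so a
   rational ball around [(u w, v w)] stays inside [U]. *)
have [N _ /(_ N (leqnn _)) /= Ne] := near_infty_natSinv_lt (PosNum e20).
have N0 : 0 < N.+1%:R^-1 :> R by rewrite invr_gt0.
have [q1 hq1] := dense_rat_mx (u w) N0.
have [q2 hq2] := dense_rat_mx (v w) N0.
exists (q1, q2, N) => //; rewrite /F; case: pselect => [|h]; last exfalso.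
  by move=> ?; split.
apply: h =>  y /= qy; apply: eU; rewrite [e]splitr.
have le12 := le_ball (ltW Ne).
apply: (ball_triangle (y := c (q1, q2))); last exact: le12.
by apply: ball_sym; apply: le12; split.
Qed.
End borel_matrices.

(** * Distance to a set, and measurability of convergence to it *)

Section distance.
Context {R : realType} {n d : nat}.
Implicit Types (A : set 'M[R]_(n, d)) (Y Z : 'M[R]_(n, d)).

Lemma dist_set_ge0 A Z : 0 <= dist_set Z A.
Proof.
rewrite /dist_set; have [->|/set0P ne] := eqVneq A set0.
  by rewrite image_set0 inf0.
by apply: lb_le_inf; [exact: image_nonempty|move=> _ [Y _ <-]; exact: sqrtr_ge0].
Qed.

Lemma continuous_enormM_dist Y : continuous (fun Z => enormM (Z - Y)).
Proof.
have csum : continuous (fun Z => \sum_(i < n) \sum_(j < d) (Z - Y) i j ^+ 2).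
  apply: continuous_big => [|i _]; first exact: add_continuous.
  apply: continuous_big => [|j _]; first exact: add_continuous.
  move=> Z; under eq_fun do rewrite !mxE.
  apply: (@continuous_comp _ _ _ (fun Z => Z i j - Y i j) (fun x => x ^+ 2)).
    by apply: continuousB; [exact: coord_continuous|exact: cst_continuous].
  exact: exprn_continuous.
move=> Z; apply: (@continuous_comp _ _ _ _ Num.sqrt); first exact: csum.
exact: sqrt_continuous.
Qed.

(** An infimum is below [r] exactly when some member is, which gives a union of open balls. For
    empty [A] this union would be empty while [dist_set] takes the default value 0. *)
Lemma open_dist_set_lt A (r : R) : A !=set0 -> open [set Z | dist_set Z A < r].
Proof.
move=> A0.
rewrite (_ : [set Z | _] = \bigcup_(Y in A) [set Z | enormM (Z - Y) < r]).
  apply: bigcup_open => Y _.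
  apply: (@open_comp _ _ (fun Z => enormM (Z - Y)) [set x | x < r]).
    by move=> Z _; exact: continuous_enormM_dist.
  exact: open_lt.
apply/seteqP; split => Z /=.
  move=> /inf_lt[|_ [Y AY <-] h]; last by exists Y.
  exact: image_nonempty.
move=> [Y AY /= h]; apply: le_lt_trans h.
apply: ge_inf; last by exists Y.
by exists 0 => _ [Y' _ <-]; exact: sqrtr_ge0.
Qed.

End distance.

Lemma polarized_nonempty (R : realType) n d : (1 <= d)%N -> polarized R n d !=set0.
Proof.
case: d => // d _.
exists (\matrix_(i, j) (delta_mx ord0 ord0 : 'rV[R]_d.+1) ord0 j).
exists (delta_mx ord0 ord0); split.
  rewrite inE /sphere /= /enorm (bigD1 ord0)//= big1 ?addr0.
    by rewrite mxE eqxx expr1n sqrtr1.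
  by move=> j /negPf j0; rewrite mxE j0 andbF expr0n.
by exists (fun=> true); apply/matrixP => i j; rewrite !mxE.
Qed.

(** Restricting the tolerances to inverses of positive integers turns convergence into countably
    many conditions, as measurability requires. *)
Lemma cvg0_ge0E (R : realType) (a : nat -> R) : (forall t, 0 <= a t) ->
  (a @ \oo --> (0 : R)) <->
  (forall k, exists N, forall t, (N <= t)%N -> a t < k.+1%:R^-1).
Proof.
move=> a0; split.
  move=> /cvgrPdist_lt h k.
  have [|N _ hN] := h k.+1%:R^-1; first by rewrite invr_gt0.
  exists N => t Nt; have := hN t Nt.
  by rewrite sub0r normrN ger0_norm.
move=> h; apply/cvgrPdist_lt => e e0.
have [k _ /(_ k (leqnn _)) /= ke] := near_infty_natSinv_lt (PosNum e0).
have [N hN] := h k.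
exists N => // t /= Nt; rewrite sub0r normrN ger0_norm//.
exact: lt_trans (hN t Nt) ke.
Qed.

Lemma measurable_cvg0_dist_set (R : realType) dO (O : measurableType dO) n d
    (A : set 'M[R]_(n, d)) (u : nat -> O -> 'M[R]_(n, d)) :
  A !=set0 -> (forall t, measurable_entries (u t)) ->
  measurable [set w | (fun t => dist_set (u t w) A) @ \oo --> (0 : R)].
Proof.
move=> A0 mu.
rewrite (_ : [set w | _] = \bigcap_k \bigcup_N \bigcap_(t in [set t | (N <= t)%N])
    [set w | dist_set (u t w) A < k.+1%:R^-1]).
  apply: bigcap_measurableType => k _; apply: bigcup_measurable => N _.
  apply: bigcap_measurableType => t _.
  apply: (measurable_pair_borel
    (B := [set p : 'M[R]_(n, d) * 'M[R]_(n, d) | dist_set p.1 A < k.+1%:R^-1])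
    (mu t) (mu t)).
  apply: sub_sigma_algebra.
  apply: (@open_comp _ _ fst [set Z | dist_set Z A < k.+1%:R^-1]).
    by move=> x _; exact: cvg_fst.
  exact: open_dist_set_lt.
apply/seteqP; split => w /=.
  move=> /cvg0_ge0E h k _; have [|N hN] := h _ k.
    by move=> t; exact: dist_set_ge0.
  by exists N.
move=> h; apply/cvg0_ge0E => [t|k]; first exact: dist_set_ge0.
by have [N _ hN] := h k I; exists N.
Qed.

(** * Euclidean norm, projection onto the sphere, Borel coordinates *)

Section spheres.
Context {R : realType} {d : nat}.
Implicit Type x : 'rV[R]_d.

Lemma enorm_ge0 x : 0 <= enorm x.
Proof. exact: sqrtr_ge0. Qed.

Lemma enorm_eq0 x : (enorm x == 0) = (x == 0).
Proof.
have s0 : 0 <= \sum_(j < d) x ord0 j ^+ 2 by apply: sumr_ge0 => j _; exact: sqr_ge0.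
apply/idP/eqP => [|->]; last first.
  by rewrite /enorm big1 ?sqrtr0// => j _; rewrite mxE expr0n.
rewrite sqrtr_eq0 => sle0; apply/rowP => j; rewrite mxE; apply/eqP.
have /eqP : \sum_(j < d) x ord0 j ^+ 2 = 0 by apply/eqP; rewrite eq_le sle0.
rewrite psumr_eq0; last by move=> *; exact: sqr_ge0.
by move=> /allP/(_ j); rewrite mem_index_enum sqrf_eq0; apply.
Qed.

Lemma enormZ (a : R) x : enorm (a *: x) = `|a| * enorm x.
Proof.
rewrite /enorm -sqrtr_sqr -sqrtrM ?sqr_ge0// mulr_sumr.
by congr Num.sqrt; apply: eq_bigr => j _; rewrite mxE exprMn.
Qed.

Lemma proj_sphere_sphere x : x != 0 -> proj_sphere x \in sphere R d.
Proof.
move=> x0; rewrite inE /sphere /= /proj_sphere enormZ.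
by rewrite ger0_norm ?invr_ge0 ?enorm_ge0// mulVf// enorm_eq0.
Qed.

Lemma borel_preimage_coord (j : 'I_d) (Y : set R) : measurable Y ->
  borel_sets ((fun x => x ord0 j) @^-1` Y).
Proof.
move=> mY.
pose O := g_sigma_algebraType [set U : set 'rV[R]_d | open U].
suff /(_ measurableT Y mY) :
    measurable_fun (setT : set O) (fun x : 'rV[R]_d => x ord0 j).
  by rewrite setTI.
apply: (measurability _ (RGenOpens.measurableE R)).
move=> _ [_ [a [b ->] <-]]; rewrite setTI; apply: sub_sigma_algebra.
apply: open_comp; last exact: interval_open.
by move=> x _; exact: coord_continuous.
Qed.

End spheres.

(** * A version of the step that is measurable everywhere *)

Section safe_step.
Context {R : realType} {n d : nat}.
Variable f : 'I_n -> 'M[R]_(n, d) -> 'rV[R]_d -> 'rV[R]_d.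

Definition admissible (X : 'M[R]_(n, d)) (z : 'rV[R]_d) : Prop :=
  (sphere_config R n d X /\ z \in sphere R d) /\
  forall i, row i X + f i X z != 0.

(* The hypotheses on [f] say nothing outside the spheres, nor for values never
   taken by the noise; freezing the dynamics there makes the step measurable
   everywhere. *)
Definition safe_step (X : 'M[R]_(n, d)) (z : 'rV[R]_d) : 'M[R]_(n, d) :=
  if `[< admissible X z >] then gstep f X z else X.

Lemma safe_step_sphere X z :
  sphere_config R n d X -> sphere_config R n d (safe_step X z).
Proof.
rewrite /safe_step; case: asboolP => // -[_ X0] _ i.
rewrite (_ : row i _ = proj_sphere (row i X + f i X z)).
  exact: proj_sphere_sphere.
by apply/rowP => j; rewrite !mxE.
Qed.

Hypothesis mf : forall i, measurable_on_spheres (f i).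

(** The set where the guard holds is measurable, and on it each entry is a measurable quotient of a
    coordinate by a norm. *)
Lemma measurable_safe_step {dO : measure_display} {O : measurableType dO}
    (u : O -> 'M[R]_(n, d)) (v : O -> 'rV[R]_d) :
  measurable_entries u -> measurable_entries v ->
  measurable_entries (fun w => safe_step (u w) (v w)).
Proof.
move=> mu mv i0 j0.
pose D := [set w | sphere_config R n d (u w) /\ v w \in sphere R d].
have mD : measurable D.
  (* Taking the whole space as target set in the measurability of [f i0] leaves only the sphere
     constraints, that is [D]. *)
  have := measurable_pair_borel mu mv
    (mf i0 (@borel_preimage_coord R d j0 _ measurableT)).
  rewrite (_ : [set w | _] = D)//.
  by apply/seteqP; split => w /=; [case=> ? []|case].
pose y i j w := (row i (u w) + f i (u w) (v w)) ord0 j.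
have my i j : measurable_fun D (y i j).
  rewrite (_ : y i j =
      (fun w => u w i j) \+ (fun w => f i (u w) (v w) ord0 j)); last first.
    by apply/funext => w; rewrite /y !mxE.
  apply: measurable_funD; first exact: measurable_funTS.
  move=> _ Y mY.
  have := measurable_pair_borel mu mv (mf i (@borel_preimage_coord R d j _ mY)).
  rewrite (_ : [set w | _] = D `&` (fun w => f i (u w) (v w) ord0 j) @^-1` Y)//.
  by apply/seteqP; split => w /=; [case=> ? []|case=> -[]].
pose N i w := enorm (row i (u w) + f i (u w) (v w)).
have mN i : measurable_fun D (N i).
  rewrite (_ : N i = Num.sqrt \o (fun w => \sum_(j < d) y i j w ^+ 2))//.
  apply: measurableT_comp.
    by apply: continuous_measurable_fun; exact: sqrt_continuous.
  by apply: measurable_sum => j; apply: measurable_funX; exact: my.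
pose G := [set w | admissible (u w) (v w)].
have mG : measurable G.
  rewrite (_ : G = D `&` \bigcap_(i in @setT 'I_n) (D `&` N i @^-1` ~` [set 0])).
    apply: measurableI => //; apply: fin_bigcap_measurable => // i _.
    by apply: mN => //; exact: measurableC.
  apply/seteqP; split => w /=; rewrite /G /= /admissible.
    move=> [Dw h]; split => // i _; split => //=.
    by apply/eqP; rewrite enorm_eq0.
  move=> [Dw h]; split => // i; have [_ /= /eqP] := h i I.
  by rewrite enorm_eq0.
(* The inverse norm becomes a real power with exponent -1, equal to it for a nonnegative base, so
   that [measurable_powR] applies. *)
rewrite (_ : (fun w => _) = (fun w =>
    if `[< admissible (u w) (v w) >] then N i0 w `^ (-1) * y i0 j0 w
    else u w i0 j0)); last first.
  apply/funext => w; rewrite /safe_step; case: asboolP => // _.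
  by rewrite powR_inv1 ?enorm_ge0// /gstep mxE /proj_sphere mxE.
apply: measurable_fun_if => //.
- apply: (measurable_fun_bool true); rewrite setTI.
  rewrite (_ : _ @^-1` _ = G)//.
  by apply/seteqP; split => w /= /asboolP.
- apply: (@measurable_funS _ _ _ _ D) => //.
    by move=> w [_ /= /asboolP[]].
  apply: measurable_funM => //.
  by apply: (measurableT_comp (f := @powR R ^~ (-1))) => //; exact: measurable_powR.
- exact: measurable_funTS.
Qed.

End safe_step.

(** * The space of noise sequences *)

Section sequences.
Context {dV : measure_display} {V : measurableType dV}.
Implicit Types (N t : nat) (B : nat -> set V) (s : nat -> V).

Definition cylinder N B : set (nat -> V) :=
  [set s | forall k, (k < N)%N -> B k (s k)].

Definition cylinders : set (set (nat -> V)) :=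
  [set C | exists N B, (forall k, measurable (B k)) /\ C = cylinder N B].

Lemma cylinders_setI : setI_closed cylinders.
Proof.
move=> _ _ [N [B [mB ->]]] [N' [B' [mB' ->]]].
exists (maxn N N'), (fun k =>
  (if (k < N)%N then B k else setT) `&` (if (k < N')%N then B' k else setT)).
split=> [k|]; first by apply: measurableI; case: ifP.
apply/seteqP; split => s /=.
  by move=> [h h'] k _; split; case: ifPn => // ?; [exact: h|exact: h'].
move=> h; split => k kN; have /h[] : (k < maxn N N')%N by rewrite leq_max kN ?orbT.
  by rewrite kN.
by rewrite kN.
Qed.

(** The product sigma-algebra on sequences, generated by the pi-system of finite-dimensional
    boxes. *)
Definition seqspace := g_sigma_algebraType cylinders.

Lemma measurable_coord k : measurable_fun setT (fun s : seqspace => s k).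
Proof.
move=> _ Y mY; rewrite setTI; apply: sub_sigma_algebra.
exists k.+1, (fun i => if i == k then Y else setT); split=> [i|].
  by case: ifP.
apply/seteqP; split => s /=; last by move=> /(_ k (ltnSn k)); rewrite eqxx.
by move=> Yk i _; case: eqP => // ->.
Qed.

Lemma measurable_fun_seqspace {dO : measure_display} {O : measurableType dO}
    (h : O -> seqspace) :
  (forall k, measurable_fun setT (fun w => h w k)) -> measurable_fun setT h.
Proof.
move=> mh; apply: (@measurability _ _ O seqspace setT h cylinders erefl).
move=> _ [_ [N [B [mB ->]]] <-]; rewrite setTI.
rewrite (_ : _ @^-1` _ =
    \bigcap_(k in [set k | (k < N)%N]) ((fun w => h w k) @^-1` B k)); last first.
  by apply/seteqP; split => w /=.
apply: bigcap_measurableType => k _.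
by rewrite -[X in measurable X]setTI; exact: mh.
Qed.

(** The second sequence is read from its index 0, so that it acts as fresh noise for a chain
    restarted at time [t]. *)
Definition splice t (p : seqspace * seqspace) : seqspace :=
  fun k => if (k < t)%N then p.1 k else p.2 (k - t)%N.

Lemma measurable_splice t : measurable_fun setT (splice t).
Proof.
apply: measurable_fun_seqspace => k; rewrite /splice; case: (k < t)%N.
  by apply: (@measurableT_comp _ _ _ (seqspace * seqspace)%type seqspace V
      (fun s => s k) setT fst);
    [exact: measurable_coord|exact: measurable_fst].
by apply: (@measurableT_comp _ _ _ (seqspace * seqspace)%type seqspace V
    (fun s => s (k - t)%N) setT snd);
  [exact: measurable_coord|exact: measurable_snd].
Qed.

HB.instance Definition _ t :=
  isMeasurableFun.Build _ _ _ _ (splice t) (measurable_splice t).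

Lemma measurable_splice_section t (E : set seqspace) s : measurable E ->
  measurable [set s' | E (splice t (s, s'))].
Proof.
move=> mE; have mtE : measurable (splice t @^-1` E).
  by rewrite -[X in measurable X]setTI; exact: measurable_splice.
rewrite (_ : [set s' | _] = xsection (splice t @^-1` E) s).
  exact: measurable_xsection.
by apply/seteqP; split => s'; rewrite /xsection /= inE.
Qed.

(** The events of the natural filtration at time [t], expressed by invariance under changes of the
    later coordinates. *)
Definition determined_before t (B : set seqspace) : Prop :=
  measurable B /\ forall s s', (forall k, (k < t)%N -> s k = s' k) -> B s -> B s'.

Lemma determined_before_le t t' (B : set seqspace) : (t <= t')%N ->
  determined_before t B -> determined_before t' B.
Proof.
move=> tt' [mB h]; split => // s s' ss'; apply: h => k kt.
by apply: ss'; exact: leq_trans kt tt'.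
Qed.

Lemma determined_beforeC t (B : set seqspace) :
  determined_before t B -> determined_before t (~` B).
Proof.
move=> [mB h]; split; first exact: measurableC.
by move=> s s' ss' nB Bs'; apply: nB; apply: h Bs' => k /ss'.
Qed.

Lemma determined_beforeU t (B B' : set seqspace) : determined_before t B ->
  determined_before t B' -> determined_before t (B `|` B').
Proof.
move=> [mB h] [mB' h']; split; first exact: measurableU.
by move=> s s' ss' [/(h _ _ ss')|/(h' _ _ ss')] ?; [left|right].
Qed.

(** * Invariance of the product law under splicing, and the Markov property *)

Section product_law.
Context {R : realType} (mu : probability seqspace R) (nu : set V -> \bar R).
Hypothesis mu_cylinder : forall N B, (forall k, measurable (B k)) ->
  mu (cylinder N B) = (\prod_(0 <= k < N) nu (B k))%E.

(** Two finite measures agreeing on the pi-system of cylinders are equal; the preimage of a cylinder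
    under [splice t] is a product of two cylinders. *)
Lemma splice_law t (A : set seqspace) : measurable A ->
  mu A = (mu \x mu)%E (splice t @^-1` A).
Proof.
move=> mA.
apply: (@measure_unique _ R seqspace cylinders (fun=> setT) _ _ _ _ mu
  (pushforward (mu \x mu)%E (splice t))) => //.
- exact: cylinders_setI.
- by move=> _; exists 0%N, (fun=> setT); split => //; apply/seteqP; split.
- by rewrite bigcup_const //; exists 0%N.
- move=> _ [N [B [mB ->]]].
  have spliceE : splice t @^-1` cylinder N B =
      cylinder (minn t N) B `*` cylinder (N - t) (fun k => B (k + t)%N).
    apply/seteqP; split => -[s s'] /=; rewrite /splice /cylinder/=.
      move=> h; split => k.
        by rewrite leq_min => /andP[kt kN]; have := h _ kN; rewrite kt.
      by rewrite ltn_subRL addnC => /h; rewrite ltnNge leq_addl addnK.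
    move=> [h h'] k kN; case: ifPn => kt; first by apply: h; rewrite leq_min kt.
    rewrite -leqNgt in kt; rewrite -{1}(subnK kt); apply: h'.
    by rewrite ltn_sub2r//; exact: leq_ltn_trans kN.
  transitivity (\prod_(0 <= k < N) nu (B k))%E; first exact: mu_cylinder.
  transitivity ((mu \x mu)%E (splice t @^-1` cylinder N B)) => //.
  rewrite spliceE product_measure1E; last 2 first.
    by apply: sub_sigma_algebra; exists (minn t N), B.
    by apply: sub_sigma_algebra; exists (N - t)%N, (fun k => B (k + t)%N).
  transitivity ((\prod_(0 <= k < minn t N) nu (B k)) *
      (\prod_(0 <= k < N - t) nu (B (k + t)%N)))%E; last first.
    by congr (_ * _)%E; apply/esym/mu_cylinder.
  have [tN|Nt] := leqP t N.
    by rewrite (big_cat_nat _ tN)//= -{2}(add0n t) big_addn.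
  (* Here [N < t]: truncated subtraction makes the second cylinder have length 0, and its empty
     product is 1. *)
  by rewrite [X in (_ * X)%E]big_geq ?mule1// leqn0 subn_eq0 ltnW.
- by move=> _; apply: (le_lt_trans (probability_le1 mu measurableT)); rewrite ltry.
Qed.

(** The hypothesis bounds from below the conditional probability of [E] given the first [t]
    coordinates; integrating over [B] gives the claim. *)
Lemma ge_mu_determined_beforeI t (B E : set seqspace) (c : R) : 0 <= c ->
  determined_before t B -> measurable E ->
  (forall s, B s -> (c%:E <= mu [set s' | E (splice t (s, s'))])%E) ->
  (c%:E * mu B <= mu (B `&` E))%E.
Proof.
move=> c0 [mB Bt] mE h; have mBE := measurableI _ _ mB mE.
rewrite (splice_law t mBE) /= /product_measure1.
have mS : measurable (splice t @^-1` (B `&` E)).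
  by rewrite -[X in measurable X]setTI; exact: measurable_splice.
(* [c * mu B] is written as the integral of [c] times the indicator of [B], to be compared pointwise
   with the measures of the sections. *)
rewrite -[X in (_ * mu X)%E]setIT -integral_indic// -ge0_integralZl//; last first.
- by apply/measurable_EFinP; exact: measurable_indic.
apply: ge0_le_integral => //.
- by move=> s _; rewrite mule_ge0 ?lee_fin.
- by apply: measurable_funeM; apply/measurable_EFinP; exact: measurable_indic.
- exact: measurable_fun_xsection.
move=> s _; rewrite indicE; case: (boolP (s \in B)); rewrite ?mule0 ?mule1//.
rewrite inE => Bs; apply: le_trans (h s Bs) _.
apply: le_measure; rewrite ?inE.
- exact: measurable_splice_section.
- exact: measurable_xsection.
move=> s'; rewrite /xsection /= inE /= => Es'; split => //.
by apply: Bt Bs => k kt; rewrite /splice kt.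
Qed.
End product_law.
End sequences.

(** * Approximation by finitely determined events, and the zero-one law *)

Section zero_one.
Context {dV : measure_display} {V : measurableType dV} {R : realType}.
Context (mu : probability (@seqspace _ V) R).
Implicit Types A B E : set (@seqspace _ V).

Let setsym A B := (A `\` B) `|` (B `\` A).

Let measurable_setsym A B : measurable A -> measurable B -> measurable (setsym A B).
Proof. by move=> mA mB; apply: measurableU; exact: measurableD. Qed.

Definition approximable A : Prop := measurable A /\
  forall e : R, 0 < e -> exists t B,
    determined_before t B /\ (mu (setsym A B) <= e%:E)%E.

Lemma determined_before_approximable t B : determined_before t B -> approximable B.
Proof.
move=> Bt; split; first exact: Bt.1.
move=> e e0; exists t, B; split => //.
by rewrite /setsym setDv setU0 measure0 lee_fin ltW.
Qed.

Lemma approximableC A : approximable A -> approximable (~` A).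
Proof.
move=> [mA h]; split; first exact: measurableC.
move=> e /h[t [B [Bt le]]]; exists t, (~` B); split; first exact: determined_beforeC.
rewrite (_ : setsym _ _ = setsym A B)//.
by rewrite /setsym !setDE !setCK setUC (setIC B) (setIC A).
Qed.

Lemma approximableU A A' : approximable A -> approximable A' ->
  approximable (A `|` A').
Proof.
move=> [mA h] [mA' h']; split; first exact: measurableU.
move=> e e0; have e20 : 0 < e / 2 by rewrite divr_gt0.
have [t [B [Bt le]]] := h _ e20; have [t' [B' [Bt' le']]] := h' _ e20.
exists (maxn t t'), (B `|` B'); split.
  apply: determined_beforeU.
    exact: determined_before_le (leq_maxl _ _) Bt.
  exact: determined_before_le (leq_maxr _ _) Bt'.
have mS := measurable_setsym mA Bt.1; have mS' := measurable_setsym mA' Bt'.1.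
apply: (@le_trans _ _ (mu (setsym A B `|` setsym A' B'))); last first.
  by apply: le_trans (measureU2 _ _ _) _ => //; rewrite [e]splitr EFinD leeD.
apply: le_measure; rewrite ?inE.
- by apply: measurable_setsym; apply: measurableU => //; [exact: Bt.1|exact: Bt'.1].
- exact: measurableU.
by move=> s; rewrite /setsym /=; tauto.
Qed.

(** By continuity from above, some finite partial union misses less than [e / 2] of the whole;
    approximating it within [e / 2] suffices. *)
Lemma approximable_bigcup (A : nat -> set (@seqspace _ V)) :
  (forall k, approximable (A k)) -> approximable (\bigcup_k A k).
Proof.
move=> hA; have mU : measurable (\bigcup_k A k).
  by apply: bigcupT_measurable => k; exact: (hA k).1.
split => // e e0; have e20 : 0 < e / 2 by rewrite divr_gt0.
pose U N := \big[setU/set0]_(k < N) A k.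
have aU N : approximable (U N).
  rewrite /U; elim: N => [|N IH]; last by rewrite big_ord_recr; exact: approximableU.
  rewrite big_ord0; apply: (@determined_before_approximable 0%N); split => //.
pose G N := (\bigcup_k A k) `\` U N.
have mG N : measurable (G N) by apply: measurableD => //; exact: (aU N).1.
have G0 : \bigcap_N G N = set0.
  apply/seteqP; split => // s hs.
  have [[k _ Aks] _] := hs 0%N I.
  have [_] := hs k.+1 I; apply.
  by rewrite /U big_ord_recr /=; right.
have niG : nonincreasing_seq G.
  move=> N N' NN'; apply/subsetPset; apply: setDS.
  exact: subset_bigsetU.
have cvgG : mu \o G @ \oo --> 0%E.
  rewrite -(measure0 mu) -G0; apply: nonincreasing_cvg_mu => //.
    by apply: (le_lt_trans (probability_le1 mu (mG _))); rewrite ltry.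
  by rewrite G0.
have [|N _ /(_ N (leqnn _)) /= GN] := cvgG [set x | (x < (e / 2)%:E)%E].
  by apply: open_ereal_lt'; rewrite lte_fin.
have [t [B [Bt le]]] := (aU N).2 _ e20.
exists t, B; split => //.
have mS := measurable_setsym (aU N).1 Bt.1.
apply: (@le_trans _ _ (mu (G N `|` setsym (U N) B))); last first.
  apply: le_trans (measureU2 _ _ _) _ => //.
  by rewrite [e]splitr EFinD leeD// ltW.
apply: le_measure; rewrite ?inE.
- exact: measurable_setsym mU Bt.1.
- exact: measurableU.
have UU s : U N s -> (\bigcup_k A k) s.
  by rewrite /U -bigcup_mkord => -[k _ ?]; exists k.
move=> s; rewrite /setsym /G /= => -[[As nB]|[Bs nA]].
  by have [Us|nUs] := pselect (U N s); [right; left|left].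
by right; right; split => // /UU.
Qed.

(** The approximable sets form a sigma-algebra containing the generating cylinders. *)
Lemma measurable_approximable A : measurable A -> approximable A.
Proof.
move: A; apply: (@smallest_sub _ _ _ approximable).
  split.
  - by apply: (@determined_before_approximable 0%N); split.
  - by move=> A; rewrite setTD; exact: approximableC.
  - exact: approximable_bigcup.
move=> _ [N [B [mB ->]]]; apply: (@determined_before_approximable N); split.
  by apply: sub_sigma_algebra; exists N, B.
by move=> s s' ss' Bs k kN; rewrite -ss'//; exact: Bs.
Qed.

(* Approximating [~` E] by [B] up to [e] forces
   [c * mu (~` E) <= c * mu B + c * e <= mu (B `&` E) + c * e <= (1 + c) * e]. *)
Lemma zero_one_law E (c : R) : measurable E -> 0 < c ->
  (forall t B, determined_before t B -> (c%:E * mu B <= mu (B `&` E))%E) ->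
  mu E = 1%E.
Proof.
move=> mE c0 h.
have mCE := measurableC mE.
suff CE0 : mu (~` E) = 0%E.
  have := probability_setC mu mCE.
  by rewrite setCK CE0 sube0.
apply/eqP; rewrite eq_le measure_ge0 andbT.
have fin A : measurable A -> mu A = (fine (mu A))%:E.
  by move=> mA; rewrite fineK// fin_num_measure.
rewrite (fin _ mCE) lee_fin leNgt; apply/negP.
set p := fine _ => p0.
(* Chosen so that [(1 + c) * e] is half of [c * p], contradicting the bound [c * p <= (1 + c) * e]
   obtained below. *)
pose e := c * p / (2 * (1 + c)).
have e0 : 0 < e by rewrite /e divr_gt0 ?mulr_gt0// addr_gt0.
have [t [B [[mB Bt] le]]] := (measurable_approximable mCE).2 _ e0.
have le1 : (mu (B `&` E) <= e%:E)%E.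
  apply: le_trans le; apply: le_measure; rewrite ?inE.
  - exact: measurableI.
  - exact: measurable_setsym.
  by move=> s [? ?]; right; split => //=; apply.
have le2 : (mu (~` E) <= mu B + e%:E)%E.
  apply: (@le_trans _ _ (mu (B `|` setsym (~` E) B))).
    apply: le_measure; rewrite ?inE//.
      by apply: measurableU => //; exact: measurable_setsym.
    move=> s nE; have [?|?] := pselect (B s); first by left.
    by right; left.
  apply: le_trans (measureU2 _ _ _) _ => //; first exact: measurable_setsym.
  by rewrite leeD2l.
have := h t B (conj mB Bt).
have mBE := measurableI _ _ mB mE.
move: le1 le2; rewrite (fin _ mBE) (fin _ mB) (fin _ mCE) -/p -EFinD -EFinM !lee_fin.
move=> le1 le2 le3.
have pe : e * (2 * (1 + c)) = c * p.
  by rewrite /e divfK// mulf_neq0// lt0r_neq0// addr_gt0.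
have : c * p <= c * (fine (mu B) + e) by rewrite ler_pM2l.
have : 0 < c * p by rewrite mulr_gt0.
nra.
Qed.

End zero_one.

(** * Trajectories as functions of the noise sequence *)

Section safe_trajectories.
Context {R : realType} {n d : nat}.
Variable f : 'I_n -> 'M[R]_(n, d) -> 'rV[R]_d -> 'rV[R]_d.

Let V := g_sigma_algebraType [set U : set 'rV[R]_d | open U].
Implicit Types (X : 'M[R]_(n, d)) (s : @seqspace _ V).

Fixpoint safe_traj X s t : 'M[R]_(n, d) :=
  if t is t'.+1 then safe_step f (safe_traj X s t') (s t') else X.

Lemma safe_traj_sphere X s t :
  sphere_config R n d X -> sphere_config R n d (safe_traj X s t).
Proof. by move=> hX; elim: t => //= t; exact: safe_step_sphere. Qed.

(** The last step before time [t] consumes the noise of index [t - 1], whence the strict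
    inequality. *)
Lemma eq_safe_traj X s s' t : (forall k, (k < t)%N -> s k = s' k) ->
  safe_traj X s t = safe_traj X s' t.
Proof.
elim: t => //= t IH ss'; rewrite ss'// IH// => k kt.
by apply: ss'; exact: ltnW.
Qed.

(** The pathwise Markov property: after time [t] the chain restarts from its current position,
    driven by [s']. *)
Lemma safe_traj_splice X s s' t k :
  safe_traj X (splice t (s, s')) (k + t) = safe_traj (safe_traj X s t) s' k.
Proof.
elim: k => /= [|k ->].
  by apply: eq_safe_traj => k kt; rewrite /splice kt.
by rewrite /splice ltnNge leq_addl /= addnK.
Qed.

(** The spheres are preserved, so every pair met along the trajectory is admissible and the guard
    never freezes it. *)
Lemma traj_safe_traj (T : Type) (xi : nat -> T -> 'rV[R]_d) X w t :
  (forall t, xi t w \in sphere R d) ->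
  (forall X t i, sphere_config R n d X -> row i X + f i X (xi t w) != 0) ->
  sphere_config R n d X ->
  traj f xi X w t = safe_traj X (fun k => xi k w) t.
Proof.
move=> xi_sphere xi0 hX; elim: t => //= t ->.
rewrite /safe_step asboolT//; split; last first.
  by move=> i; apply: xi0; exact: safe_traj_sphere.
by split => //; exact: safe_traj_sphere.
Qed.

Definition safe_polarization X : set (@seqspace _ V) :=
  [set s | (fun t => dist_set (safe_traj X s t) (polarized R n d)) @ \oo
           --> (0 : R)].

(** A limit is unaffected by dropping the first [t] terms. *)
Lemma safe_polarization_splice X s s' t :
  safe_polarization (safe_traj X s t) s' -> safe_polarization X (splice t (s, s')).
Proof.
rewrite /safe_polarization /= => h; rewrite -(cvg_shiftn t).
by under eq_fun do rewrite safe_traj_splice.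
Qed.

Hypothesis mf : forall i, measurable_on_spheres (f i).

Lemma measurable_safe_traj X t :
  measurable_entries (fun s : @seqspace _ V => safe_traj X s t).
Proof.
elim: t => [|t IH] /=; first by move=> i j; exact: measurable_cst.
apply: measurable_safe_step => // i j _ Y mY.
rewrite setTI (ord1 i).
have := @measurable_coord _ V t measurableT _ (borel_preimage_coord j mY).
by rewrite setTI.
Qed.

Lemma measurable_safe_polarization X : (1 <= d)%N ->
  measurable (safe_polarization X).
Proof.
move=> d1; apply: measurable_cvg0_dist_set; first exact: polarized_nonempty.
exact: measurable_safe_traj.
Qed.

End safe_trajectories.

(** * Transfer to the law of the noise, and conclusion *)

Unset Implicit Arguments. Set Strict Implicit.

Theorem theorem3p1 (R : realType) (n d : nat) (dT : measure_display)
  (T : measurableType dT) (P : probability T R)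
  (xi : nat -> T -> 'rV[R]_d)
  (f : 'I_n -> 'M[R]_(n, d) -> 'rV[R]_d -> 'rV[R]_d) :
  (1 <= n)%N -> (1 <= d)%N ->
  iid_sphere_noise P xi ->
  (forall i, measurable_on_spheres (f i)) ->
  (forall (X : 'M[R]_(n, d)) (t : nat) (w : T) (i : 'I_n),
     sphere_config R n d X -> row i X + f i X (xi t w) != 0) ->
  (forall X0, sphere_config R n d X0 ->
     P (polarization_event f xi X0) = 1%E)
  <->
  (exists c : R, 0 < c /\
     forall X0, sphere_config R n d X0 ->
       (c%:E <= P (polarization_event f xi X0))%E).
Proof.
move=> n1 d1 [mxi xi_sphere xi_id xi_indep] mf f0; split.
  by move=> h; exists 1; split => // X0 /h ->.
move=> [c [c0 hc]] X0 hX0.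
pose V := g_sigma_algebraType [set U : set 'rV[R]_d | open U].
pose noise (w : T) : @seqspace _ V := fun k => xi k w.
have mnoise : measurable_fun setT noise.
  apply: measurable_fun_seqspace => k _ Y mY; rewrite setTI; exact: mxi.
pose noise_mixin := isMeasurableFun.Build _ _ _ _ noise mnoise.
pose noise_mfun : {mfun T >-> @seqspace _ V} := HB.pack noise noise_mixin.
pose mu := distribution P noise_mfun.
have eventE X : sphere_config R n d X ->
    P (polarization_event f xi X) = mu (safe_polarization f X).
  move=> hX; have trajE w : (fun t => dist_set (traj f xi X w t) (polarized R n d)) =
      (fun t => dist_set (safe_traj f X (noise w) t) (polarized R n d)).
    apply/funext => t; rewrite (traj_safe_traj t (xi_sphere^~ w) _ hX)//.
    by move=> X' t' i; exact: f0.
  transitivity (P (noise @^-1` safe_polarization f X)) => //.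
  by congr (P _); apply/seteqP; split => w;
    rewrite /polarization_event /safe_polarization /= trajE.
pose nu (B : set V) := P (xi 0%N @^-1` B).
(* Independence factors the probability of a cylinder, and identical distribution replaces each
   factor by the law [nu] of the first noise. *)
have mu_cylinder N (B : nat -> set V) : (forall k, measurable (B k)) ->
    mu (cylinder N B) = (\prod_(0 <= k < N) nu (B k))%E.
  move=> mB; have := xi_indep (index_iota 0 N) B (iota_uniq _ _) mB.
  rewrite (eq_bigr (fun k => nu (B k))); last first.
    by move=> k _; exact: xi_id (mB k).
  move=> <-; transitivity (P (noise @^-1` cylinder N B)) => //.
  congr (P _); apply/seteqP; split => w h k.
    by rewrite /= mem_index_iota => kN; exact: h.
  by move=> kN; apply: h; rewrite /= mem_index_iota.
rewrite eventE//; apply: (zero_one_law _ c0).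
  exact: measurable_safe_polarization.
move=> t B Bt; apply: (ge_mu_determined_beforeI mu_cylinder (ltW c0) Bt).
  exact: measurable_safe_polarization.
(* The position at time [t] is again a configuration on the spheres, so the bound [c], uniform in
   the starting point, applies to the restarted chain. *)
move=> s _; have hs := safe_traj_sphere f s t hX0.
rewrite (le_trans (hc _ hs))// eventE//.
apply: le_measure; rewrite ?inE.
- exact: measurable_safe_polarization.
- by apply: measurable_splice_section; exact: measurable_safe_polarization.
by move=> s' /safe_polarization_splice.
Qed.
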